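(* Let $H$ and $K$ be Hopf algebras such that $K$ is an $H$-module algebra via an algebra action $\rightharpoonup:H\to\mathrm{End}(K)$. A coalgebra homomorphism $\pi:H\to K$ is a Hopf algebra crossed homomorphism (with respect to $\rightharpoonup$) if and only if the action $$a\cdot_\pi x:=\pi(a_1)(a_2\rightharpoonup x),\quad \forall x\in K,\ a\in H,$$ defines an $H$-module structure on $K$.
   Context: Everything is over a field $\mathbf{k}$ of characteristic $0$. Sweedler notation: $\Delta(a)=a_1\otimes a_2$. $K$ is an $H$-module algebra via an algebra action $\rightharpoonup$ if $a\rightharpoonup 1=\varepsilon(a)1$ and $a\rightharpoonup(xy)=(a_1\rightharpoonup x)(a_2\rightharpoonup y)$ for all $a\in H$, $x,y\in K$. A Hopf algebra crossed homomorphism $\pi:H\to K$ with respect to $\rightharpoonup$ is a coalgebra homomorphism with $\pi(ab)=\pi(a_1)(a_2\rightharpoonup\pi(b))$ for all $a,b\in H$. *)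

(* Defs.v *)
From HB Require Import structures.
From mathcomp Require Import all_boot all_order all_algebra.
From mathcomp Require Import boolp.

Set Implicit Arguments.
Unset Strict Implicit.
Unset Printing Implicit Defensive.

Import GRing.Theory.
Local Open Scope ring_scope.
Local Open Scope quotient_scope.

Lemma bilinear_forI (k : fieldType) (A B W : lmodType k) (f : A -> B -> W) :
  (forall v, linear (f^~ v)) -> (forall u, linear (f u)) ->
  bilinear_for (GRing.Scale.Law.clone _ _ *:%R _) (GRing.Scale.Law.clone _ _ *:%R _) f.
Proof. by []. Qed.

Section TensorQuotient.
Variables (k : fieldType) (A B : lmodType k).

(* A list of pairs stands for the formal sum of its elements; [teq] is the
   congruence on formal sums generated by the bilinearity relations. *)
Inductive teq : seq (A * B) -> seq (A * B) -> Prop :=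
| teq_refl s : teq s s
| teq_sym s t : teq s t -> teq t s
| teq_trans s t r : teq s t -> teq t r -> teq s r
| teq_cat s s' t t' : teq s s' -> teq t t' -> teq (s ++ t) (s' ++ t')
| teq_catC s t : teq (s ++ t) (t ++ s)
| teq_addl u u' v : teq [:: (u + u', v)] [:: (u, v); (u', v)]
| teq_addr u v v' : teq [:: (u, v + v')] [:: (u, v); (u, v')]
| teq_scale c u v : teq [:: (c *: u, v)] [:: (u, c *: v)]
| teq_zero v : teq [:: (0, v)] [::].

Definition teqb (s t : seq (A * B)) : bool := `[< teq s t >].

Lemma teqbP s t : reflect (teq s t) (teqb s t).
Proof. exact: asboolP. Qed.

Lemma teqb_refl : reflexive teqb.
Proof. by move=> s; apply/teqbP; apply: teq_refl. Qed.

Lemma teqb_sym : symmetric teqb.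
Proof. by move=> s t; apply/teqbP/teqbP; apply: teq_sym. Qed.

Lemma teqb_trans : transitive teqb.
Proof.
by move=> s t r /teqbP st /teqbP sr; apply/teqbP; apply: teq_trans sr.
Qed.

Canonical teqb_equiv := EquivRel teqb teqb_refl teqb_sym teqb_trans.

Definition tensor := {eq_quot teqb}.
HB.instance Definition _ := Choice.on tensor.
HB.instance Definition _ := EqQuotient.on tensor.

Definition tcls (s : seq (A * B)) : tensor := \pi_tensor s.

Lemma tcls_repr x : tcls (repr x) = x.
Proof. exact: reprK. Qed.

Lemma tensor_eq s t : tcls s = tcls t <-> teq s t.
Proof.
split=> [/eqquotP/teqbP //|st].
by apply/eqquotP/teqbP.
Qed.

Definition tens (u : A) (v : B) : tensor := tcls [:: (u, v)].

Definition scale_fs (c : k) (s : seq (A * B)) := [seq (c *: p.1, p.2) | p <- s].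

Lemma scale_fs_teq c s t : teq s t -> teq (scale_fs c s) (scale_fs c t).
Proof.
elim=> {s t}.
- by move=> s; apply: teq_refl.
- by move=> s t _; apply: teq_sym.
- by move=> s t r _ IH1 _; apply: teq_trans.
- by move=> s s' t t' _ IH1 _ IH2; rewrite /scale_fs !map_cat; apply: teq_cat.
- by move=> s t; rewrite /scale_fs !map_cat; apply: teq_catC.
- by move=> u u' v /=; rewrite scalerDr; apply: teq_addl.
- by move=> u v v' /=; apply: teq_addr.
- by move=> d u v /=; rewrite scalerA mulrC -scalerA; apply: teq_scale.
- by move=> v /=; rewrite scaler0; apply: teq_zero.
Qed.

Lemma teq_scale_zero s : teq (scale_fs 0 s) [::].
Proof.
elim: s => [|[u v] s IH]; first exact: teq_refl.
rewrite /= scale0r; exact: (teq_cat (teq_zero v) IH).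
Qed.

Lemma teq_scaleDl a b s : teq (scale_fs (a + b) s) (scale_fs a s ++ scale_fs b s).
Proof.
elim: s => [|[u v] s IH]; first exact: teq_refl.
rewrite /= scalerDl.
have h := teq_cat (teq_addl (a *: u) (b *: u) v) IH.
apply: teq_trans h _ => /=.
apply: (@teq_cat [:: _] [:: _]); first exact: teq_refl.
rewrite -cat1s -[(b *: u, v) :: scale_fs b s]cat1s !catA.
by apply: teq_cat; [apply: teq_catC | apply: teq_refl].
Qed.

Definition tadd (x y : tensor) : tensor := tcls (repr x ++ repr y).
Definition tscale (c : k) (x : tensor) : tensor := tcls (scale_fs c (repr x)).
Definition topp (x : tensor) : tensor := tscale (- 1) x.
Definition tzero : tensor := tcls [::].

Lemma teq_repr s : teq (repr (tcls s)) s.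
Proof. by apply/tensor_eq; rewrite tcls_repr. Qed.

Lemma tadd_pi s t : tadd (tcls s) (tcls t) = tcls (s ++ t).
Proof. by apply/tensor_eq; apply: teq_cat; apply: teq_repr. Qed.

Lemma tscale_pi c s : tscale c (tcls s) = tcls (scale_fs c s).
Proof. by apply/tensor_eq; apply: scale_fs_teq; apply: teq_repr. Qed.

Lemma taddA : associative tadd.
Proof.
move=> x y z; rewrite -[x]tcls_repr -[y]tcls_repr -[z]tcls_repr.
by rewrite !tadd_pi catA.
Qed.

Lemma taddC : commutative tadd.
Proof.
move=> x y; rewrite -[x]tcls_repr -[y]tcls_repr !tadd_pi.
by apply/tensor_eq; apply: teq_catC.
Qed.

Lemma tadd0 : left_id tzero tadd.
Proof. by move=> x; rewrite -[x]tcls_repr tadd_pi. Qed.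

Lemma tscale1 : left_id 1 tscale.
Proof.
move=> x; rewrite -[x in LHS]tcls_repr tscale_pi -[RHS]tcls_repr; congr tcls.
by rewrite /scale_fs -[RHS]map_id; apply: eq_map => -[u v]; rewrite /= scale1r.
Qed.

Lemma tscaleDl x : {morph tscale^~ x : a b / a + b >-> tadd a b}.
Proof.
move=> a b; rewrite -[x]tcls_repr !tscale_pi tadd_pi.
by apply/tensor_eq; apply: teq_scaleDl.
Qed.

Lemma taddN : left_inverse tzero topp tadd.
Proof.
move=> x; rewrite -[x in tadd _ x]tscale1 -tscaleDl addNr.
by rewrite -[x]tcls_repr tscale_pi; apply/tensor_eq; apply: teq_scale_zero.
Qed.

HB.instance Definition _ := GRing.isZmodule.Build tensor taddA taddC tadd0 taddN.

Lemma tscaleA a b (x : tensor) : tscale a (tscale b x) = tscale (a * b) x.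
Proof.
rewrite -[x]tcls_repr !tscale_pi; congr tcls.
by rewrite /scale_fs -map_comp; apply: eq_map => -[u v]; rewrite /= scalerA.
Qed.

Lemma tscaleDr : right_distributive tscale (@GRing.add tensor).
Proof.
move=> c x y; rewrite /GRing.add /= -[x]tcls_repr -[y]tcls_repr.
by rewrite !(tadd_pi, tscale_pi) /scale_fs map_cat.
Qed.

HB.instance Definition _ :=
  GRing.Zmodule_isLmodule.Build k tensor tscaleA tscale1 tscaleDr tscaleDl.

Lemma tclsD s t : tcls s + tcls t = tcls (s ++ t).
Proof. exact: tadd_pi. Qed.

Lemma tclsZ c s : c *: tcls s = tcls (scale_fs c s).
Proof. exact: tscale_pi. Qed.

Lemma tens_bilinear :
  bilinear_for (GRing.Scale.Law.clone _ _ *:%R _) (GRing.Scale.Law.clone _ _ *:%R _)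
    tens.
Proof.
apply: bilinear_forI => [v c u u'|u c v v'] /=.
- rewrite /tens tclsZ tclsD.
  by apply/tensor_eq; apply: teq_addl.
- rewrite /tens tclsZ tclsD.
  apply/tensor_eq; apply: teq_trans (teq_addr _ _ _) _.
  by apply: (@teq_cat [:: _] [:: _] [:: _] [:: _]);
    [apply/teq_sym/teq_scale | apply: teq_refl].
Qed.

HB.instance Definition _ :=
  bilinear_isBilinear.Build k A B tensor _ _ tens tens_bilinear.

Lemma tensorE (x : tensor) : x = \sum_(p <- repr x) tens p.1 p.2.
Proof.
rewrite -[LHS]tcls_repr; elim: (repr x) => [|[u v] s IH]; first by rewrite big_nil.
by rewrite big_cons -IH -cat1s -tclsD.
Qed.

Lemma tensor_ind (P : tensor -> Prop) :
  P 0 -> (forall u v x, P x -> P (tens u v + x)) -> forall x, P x.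
Proof.
move=> P0 PS x; rewrite [x]tensorE; elim: (repr x) => [|[u v] s IH].
  by rewrite big_nil.
by rewrite big_cons; apply: PS.
Qed.

End TensorQuotient.

Arguments tensor {k} A B.
Arguments tens {k A B} u v : simpl never.

Section TensTheory.
Variables (k : fieldType) (A B : lmodType k).

Lemma tensPl c (u u' : A) (v : B) :
  tens (c *: u + u') v = c *: tens u v + tens u' v.
Proof. exact: (tens_bilinear A B).1. Qed.

Lemma tensPr c (u : A) (v v' : B) :
  tens u (c *: v + v') = c *: tens u v + tens u v'.
Proof. exact: (tens_bilinear A B).2. Qed.

End TensTheory.

(* [tlift f] is well defined because [f] is bilinear: see [tlift_pi] and
   [tliftE], and [tensor_ext] for uniqueness. *)
Section Lift.
Variables (k : fieldType) (A B W : lmodType k) (f : {bilinear A -> B -> W}).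

Definition tlift (x : tensor A B) : W := \sum_(p <- repr x) f p.1 p.2.

Lemma teq_lift s t :
  teq s t -> \sum_(p <- s) f p.1 p.2 = \sum_(p <- t) f p.1 p.2.
Proof.
elim=> {s t} //.
- by move=> s t r _ -> _ ->.
- by move=> s s' t t' _ h1 _ h2; rewrite !big_cat /= h1 h2.
- by move=> s t; rewrite !big_cat /= addrC.
- by move=> u u' v; rewrite !big_cons !big_nil /= !addr0 linearDl.
- by move=> u v v'; rewrite !big_cons !big_nil /= !addr0 linearDr.
- by move=> c u v; rewrite !big_cons !big_nil /= !addr0 linearZl_LR linearZr_LR.
- by move=> v; rewrite big_cons big_nil /= linear0l addr0.
Qed.

Lemma tlift_pi s : tlift (tcls s) = \sum_(p <- s) f p.1 p.2.
Proof. by apply/teq_lift/teq_repr. Qed.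

Lemma tlift_linear : linear tlift.
Proof.
move=> c x y; rewrite -[x]tcls_repr -[y]tcls_repr tclsZ tclsD !tlift_pi.
rewrite big_cat /= scaler_sumr big_map; congr (_ + _).
by apply: eq_bigr => p _; rewrite linearZl_LR.
Qed.

HB.instance Definition _ := GRing.isLinear.Build k (tensor A B) W _ tlift tlift_linear.

Lemma tliftD x y : tlift (x + y) = tlift x + tlift y.
Proof. exact: linearD. Qed.

Lemma tliftE u v : tlift (tens u v) = f u v.
Proof. by rewrite tlift_pi big_seq1. Qed.

End Lift.

Lemma tensor_ext (k : fieldType) (A B W : lmodType k)
    (f g : {linear tensor A B -> W}) :
  (forall u v, f (tens u v) = g (tens u v)) -> f =1 g.
Proof.
move=> fg; elim/tensor_ind => [|u v x IH]; first by rewrite !linear0.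
by rewrite !linearD fg IH.
Qed.

(* In Sweedler notation, [tlift (bcomp m f g) (comul a)] is
   [m (f a_1) (g a_2)]. *)
Definition bcomp (k : fieldType) (A B U V W : lmodType k)
    (m : {bilinear U -> V -> W}) (f : {linear A -> U}) (g : {linear B -> V})
    (a : A) (b : B) : W := m (f a) (g b).

Lemma bcomp_bilinear (k : fieldType) (A B U V W : lmodType k)
    (m : {bilinear U -> V -> W}) (f : {linear A -> U}) (g : {linear B -> V}) :
  bilinear_for (GRing.Scale.Law.clone _ _ *:%R _) (GRing.Scale.Law.clone _ _ *:%R _)
    (bcomp m f g).
Proof.
apply: bilinear_forI => [b c a a'|a c b b']; rewrite /bcomp /=.
- by rewrite linearP linearPl.
- by rewrite linearP linearPr.
Qed.

HB.instance Definition _ (k : fieldType) (A B U V W : lmodType k)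
    (m : {bilinear U -> V -> W}) (f : {linear A -> U}) (g : {linear B -> V}) :=
  bilinear_isBilinear.Build k A B W _ _ (bcomp m f g) (bcomp_bilinear m f g).

Definition tmap (k : fieldType) (A B U V : lmodType k)
    (f : {linear A -> U}) (g : {linear B -> V}) : {linear tensor A B -> tensor U V} :=
  tlift (bcomp tens f g).

Lemma tmapE (k : fieldType) (A B U V : lmodType k)
    (f : {linear A -> U}) (g : {linear B -> V}) u v :
  tmap f g (tens u v) = tens (f u) (g v).
Proof. exact: tliftE. Qed.

Section Associator.
Variables (k : fieldType) (A B C : lmodType k).

Definition assoc_fun (x : tensor A B) (c : C) : tensor A (tensor B C) :=
  tmap idfun (applyr tens c) x.

Lemma assoc_fun_bilinear :
  bilinear_for (GRing.Scale.Law.clone _ _ *:%R _) (GRing.Scale.Law.clone _ _ *:%R _)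
    assoc_fun.
Proof.
apply: bilinear_forI => [c a x y|x a c c']; rewrite /assoc_fun.
  by rewrite linearP.
elim/tensor_ind: x => [|u v x IH]; first by rewrite !raddf0 ?scaler0 addr0.
rewrite !linearD IH !tmapE /=.
by rewrite !tensPr ?scalerDr addrACA.
Qed.

HB.instance Definition _ :=
  bilinear_isBilinear.Build k (tensor A B) C (tensor A (tensor B C)) _ _
    assoc_fun assoc_fun_bilinear.

Definition tassoc : {linear tensor (tensor A B) C -> tensor A (tensor B C)} :=
  tlift assoc_fun.

Lemma tassocE a b c : tassoc (tens (tens a b) c) = tens a (tens b c).
Proof. by rewrite [LHS]tliftE; apply: tmapE. Qed.

End Associator.

Section AlgebraMul.
Variables (k : fieldType) (A : algType k).

Definition amul (a b : A) : A := a * b.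

Lemma amul_bilinear :
  bilinear_for (GRing.Scale.Law.clone _ _ *:%R _) (GRing.Scale.Law.clone _ _ *:%R _)
    amul.
Proof.
apply: bilinear_forI => [b c a a'|a c b b']; rewrite /amul /=.
- by rewrite mulrDl scalerAl.
- by rewrite mulrDr scalerAr.
Qed.

HB.instance Definition _ :=
  bilinear_isBilinear.Build k A A A _ _ amul amul_bilinear.
HB.instance Definition _ a :=
  GRing.isLinear.Build k A A _ (amul a) (amul_bilinear.2 a).

End AlgebraMul.

Section TensorMul.
Variables (k : fieldType) (A B : algType k).

Definition tmul_fun (y : tensor A B) (a : A) (b : B) : tensor A B :=
  tmap (amul a) (amul b) y.

Lemma tmul_fun_bilinear y :
  bilinear_for (GRing.Scale.Law.clone _ _ *:%R _) (GRing.Scale.Law.clone _ _ *:%R _)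
    (tmul_fun y).
Proof.
apply: bilinear_forI => [b c a a'|a c b b']; rewrite /tmul_fun;
  elim/tensor_ind: y => [|u v y IH]; try by rewrite !raddf0 ?scaler0 addr0.
- rewrite !linearD IH !tmapE /= /amul mulrDl -scalerAl tensPl.
  by rewrite ?scalerDr addrACA.
- rewrite !linearD IH !tmapE /= /amul mulrDl -scalerAl tensPr.
  by rewrite ?scalerDr addrACA.
Qed.

HB.instance Definition _ y :=
  bilinear_isBilinear.Build k A B (tensor A B) _ _ (tmul_fun y) (tmul_fun_bilinear y).

(* Product of the tensor product algebra: (a (x) b)(c (x) d) = ac (x) bd. *)
Definition tmul (x y : tensor A B) : tensor A B := tlift (tmul_fun y) x.

Lemma tmulE a b c d : tmul (tens a b) (tens c d) = tens (a * c) (b * d).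
Proof. by rewrite [LHS]tliftE; apply: tmapE. Qed.

Lemma tmul_linearl y : linear (tmul^~ y).
Proof. by move=> c x x'; rewrite /tmul linearP. Qed.

Lemma tmul_linearr x : linear (tmul x).
Proof.
move=> c y y'; rewrite /tmul; elim/tensor_ind: x => [|u v x IH].
  by rewrite !raddf0 ?scaler0 addr0.
by rewrite !tliftD IH !tliftE /= /tmul_fun linearP scalerDr addrACA.
Qed.

End TensorMul.

Definition counit_left (k : fieldType) (V : lmodType k) (e : {scalar V})
    (u v : V) : V := e u *: v.
Definition counit_right (k : fieldType) (V : lmodType k) (e : {scalar V})
    (u v : V) : V := e v *: u.

Lemma counit_left_bilinear (k : fieldType) (V : lmodType k) (e : {scalar V}) :
  bilinear_for (GRing.Scale.Law.clone _ _ *:%R _) (GRing.Scale.Law.clone _ _ *:%R _)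
    (counit_left e).
Proof.
apply: bilinear_forI => [v c u u'|u c v v']; rewrite /counit_left /=.
- by rewrite linearP scalerDl scalerA.
- by rewrite scalerDr !scalerA mulrC.
Qed.

Lemma counit_right_bilinear (k : fieldType) (V : lmodType k) (e : {scalar V}) :
  bilinear_for (GRing.Scale.Law.clone _ _ *:%R _) (GRing.Scale.Law.clone _ _ *:%R _)
    (counit_right e).
Proof.
apply: bilinear_forI => [v c u u'|u c v v']; rewrite /counit_right /=.
- by rewrite scalerDr !scalerA mulrC.
- by rewrite linearP scalerDl scalerA.
Qed.

HB.instance Definition _ (k : fieldType) (V : lmodType k) (e : {scalar V}) :=
  bilinear_isBilinear.Build k V V V _ _ (counit_left e) (counit_left_bilinear e).
HB.instance Definition _ (k : fieldType) (V : lmodType k) (e : {scalar V}) :=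
  bilinear_isBilinear.Build k V V V _ _ (counit_right e) (counit_right_bilinear e).

HB.mixin Record isHopfAlgebra (k : fieldType) H of GRing.Algebra k H := {
  comul : {linear H -> tensor H H};
  counit : {scalar H};
  antipode : {linear H -> H};
  coassoc : forall a,
    tassoc H H H (tmap comul idfun (comul a)) = tmap idfun comul (comul a);
  counitl : forall a, tlift (counit_left counit) (comul a) = a;
  counitr : forall a, tlift (counit_right counit) (comul a) = a;
  comul1 : comul 1 = tens 1 1;
  comulM : forall a b, comul (a * b) = tmul (comul a) (comul b);
  counit1 : counit 1 = 1;
  counitM : forall a b, counit (a * b) = counit a * counit b;
  antipodel : forall a, tlift (bcomp (@amul k H) antipode idfun) (comul a) = (counit a)%:A;
  antipoder : forall a, tlift (bcomp (@amul k H) idfun antipode) (comul a) = (counit a)%:A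
}.

#[short(type="hopfAlgType")]
HB.structure Definition HopfAlgebra (k : fieldType) :=
  { H of GRing.Algebra k H & isHopfAlgebra k H }.

Definition module_action (k : fieldType) (A : algType k) (V : lmodType k)
    (act : A -> V -> V) : Prop :=
  [/\ forall x, linear (act^~ x),
      forall a, linear (act a),
      forall x, act 1 x = x
    & forall a b x, act (a * b) x = act a (act b x)].

Section CrossedHom.
Variables (k : fieldType) (H K : hopfAlgType k).

Definition coalgebra_hom (pi : {linear H -> K}) : Prop :=
  (forall a, comul (pi a) = tmap pi pi (comul a))
  /\ (forall a, counit (pi a) = counit a).

Variable act : {bilinear H -> K -> K}.

Definition module_algebra : Prop :=
  [/\ module_action act,
      forall a, act a 1 = (counit a)%:A
    & forall a x y,
        act a (x * y) =
        tlift (bcomp (@amul k K) (applyr act x) (applyr act y)) (comul a)].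

Variable pi : {linear H -> K}.

Definition twisted_act (a : H) (x : K) : K :=
  tlift (bcomp (@amul k K) pi (applyr act x)) (comul a).

Definition crossed_hom : Prop :=
  coalgebra_hom pi
  /\ (forall a b, pi (a * b) =
        tlift (bcomp (@amul k K) pi (applyr act (pi b))) (comul a)).

End CrossedHom.

(* Main.v *)
Require Import Defs.
From HB Require Import structures.
From mathcomp Require Import all_boot all_order all_algebra.
Import GRing.Theory.
Local Open Scope ring_scope.

(** Write [a . x] for the twisted action [pi(a_1) (a_2 |> x)] of [a] on [x].
    Since [a |> 1 = e(a) 1], where [e] is the counit, the counit axiom gives [a . 1 = pi(a)]
    ([twisted_act_one]), and the crossed homomorphism identity reads
    [pi(a b) = a . pi(b)].  If [.] is a module structure, this identity is
    associativity of [.] evaluated at [1].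

    Conversely, coassociativity and the module algebra axiom give the Leibniz
    rule [a . (x y) = (a_1 . x) (a_2 |> y)] ([twisted_act_mul]).  Hence, for a
    crossed homomorphism,
      [(a b) . x = pi(a_1 b_1) (a_2 b_2 |> x)
                 = (a_1 . pi(b_1)) (a_2 |> (b_2 |> x))
                 = a . (pi(b_1) (b_2 |> x)) = a . (b . x)].
    The unit law needs [pi(1) = 1]: the element [pi(1)] is group-like, hence
    invertible thanks to the antipode, and the crossed homomorphism identity
    at [a = b = 1] makes it idempotent. *)

Section TensorAlgebra.
Variables (k : fieldType) (A B : algType k).

Lemma tmul_bilinear :
  bilinear_for (GRing.Scale.Law.clone _ _ *:%R _) (GRing.Scale.Law.clone _ _ *:%R _)
    (@tmul k A B).
Proof. exact: bilinear_forI (@tmul_linearl k A B) (@tmul_linearr k A B). Qed.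

HB.instance Definition _ :=
  bilinear_isBilinear.Build k (tensor A B) (tensor A B) (tensor A B) _ _
    (@tmul k A B) tmul_bilinear.

End TensorAlgebra.

Section TwistedAction.
Variables (k : fieldType) (H K : hopfAlgType k).
Variables (act : {bilinear H -> K -> K}) (pi : {linear H -> K}).

Lemma twisted_act_bilinear :
  bilinear_for (GRing.Scale.Law.clone _ _ *:%R _) (GRing.Scale.Law.clone _ _ *:%R _)
    (twisted_act act pi).
Proof.
apply: bilinear_forI => [x c a b|a c x y]; rewrite /twisted_act.
  by rewrite !linearP.
elim/tensor_ind: (comul a) => [|u v t IH]; first by rewrite !raddf0 addr0.
rewrite !tliftD IH !tliftE /bcomp /= linearPr /amul mulrDr -scalerAr.
by rewrite scalerDr addrACA.
Qed.

HB.instance Definition _ :=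
  bilinear_isBilinear.Build k H K K _ _ (twisted_act act pi) twisted_act_bilinear.

Hypothesis act_modalg : module_algebra act.

Lemma twisted_act_one a : twisted_act act pi a 1 = pi a.
Proof.
case: act_modalg => _ act1 _.
rewrite -[in RHS](counitr a) /twisted_act.
elim/tensor_ind: (comul a) => [|u v t IH]; first by rewrite !linear0.
rewrite !tliftD linearD IH !tliftE /bcomp /counit_right /amul /= act1.
by rewrite [in RHS]linearZ; congr (_ + _); apply: mulr_algr.
Qed.

(** Both sides are [pi(a_1) (a_2 |> x) (a_3 |> y)], read off from the two
    bracketings of the iterated coproduct. *)
Lemma twisted_act_mul a x y :
  twisted_act act pi a (x * y) =
  tlift (bcomp (@amul k K) (applyr (twisted_act act pi) x) (applyr act y)) (comul a).
Proof.
case: act_modalg => _ _ actM.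
pose F := tlift (bcomp (@amul k K) pi
  (tlift (bcomp (@amul k K) (applyr act x) (applyr act y)))).
transitivity (F (tmap idfun comul (comul a))).
  rewrite /twisted_act /F.
  elim/tensor_ind: (comul a) => [|u v t IH]; first by rewrite !linear0.
  by rewrite !linearD /= IH tmapE !tliftE /bcomp /= actM.
rewrite -coassoc /F.
elim/tensor_ind: (comul a) => [|u v t IH]; first by rewrite !linear0.
rewrite !linearD /= IH tmapE [in RHS]tliftE; congr (_ + _).
rewrite -[RHS]/(twisted_act act pi u x * act v y) /twisted_act.
elim/tensor_ind: (comul u) => [|p q s IHs].
  by rewrite [tens 0 v]linear0l !raddf0 mul0r.
rewrite [tens _ v]linearDl !linearD [RHS]mulrDl; congr (_ + _); last exact: IHs.
by rewrite tassocE /= !tliftE /bcomp /= tliftE /bcomp /= /amul mulrA.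
Qed.

Hypothesis pi_crossed : crossed_hom act pi.

(** An idempotent with a left inverse is [1]; the left inverse of [pi(1)] is its
    antipode, since [pi] sends the group-like element [1] to a group-like one. *)
Lemma crossed_hom1 : pi 1 = 1.
Proof.
case: act_modalg pi_crossed => -[_ _ act_id _] _ _ [[pi_comul pi_counit] piM].
have pi_idem : pi 1 * pi 1 = pi 1.
  by rewrite -[RHS](congr1 pi (mulr1 1)) piM comul1 tliftE /bcomp /= act_id.
have pi_inv : antipode (pi 1) * pi 1 = 1.
  have := antipodel (pi 1).
  by rewrite pi_comul pi_counit comul1 counit1 tmapE tliftE scale1r.
by rewrite -[LHS]mul1r -pi_inv -mulrA pi_idem.
Qed.

(** The identity is proved for one summand [b_1 (x) b_2 = p (x) q] at a time:
    the Leibniz rule applied to [a . (pi(p) (q |> x))] turns the right-hand side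
    into [(a_1 . pi(p)) (a_2 |> (q |> x))], and the crossed homomorphism identity
    recognises [a_1 . pi(p)] as [pi(a_1 p)]. *)
Lemma twisted_actA a b x :
  twisted_act act pi (a * b) x = twisted_act act pi a (twisted_act act pi b x).
Proof.
case: act_modalg pi_crossed => -[_ _ _ actA] _ _ [_ piM].
rewrite {1}/twisted_act comulM [twisted_act act pi b x]/twisted_act.
elim/tensor_ind: (comul b) => [|p q t IH]; first by rewrite linear0r !raddf0 linear0r.
rewrite linearDr !linearD /= linearDr IH /=; congr (_ + _).
rewrite !tliftE [in RHS]/bcomp twisted_act_mul /=.
elim/tensor_ind: (comul a) => [|u v s IHs]; first by rewrite linear0l !raddf0.
rewrite linearDl !linearD /= IHs /= tmulE !tliftE /bcomp /=.
by rewrite piM actA.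
Qed.

End TwistedAction.

Theorem theorem4p3 (k : fieldType) (k_char0 : [pchar k] =i pred0)
    (H K : hopfAlgType k) (act : {bilinear H -> K -> K})
    (act_modalg : module_algebra act)
    (pi : {linear H -> K}) (pi_coalg : coalgebra_hom pi) :
  crossed_hom act pi <-> module_action (twisted_act act pi).
Proof.
split=> [pi_crossed | [_ _ _ twA]].
  have [twl twr] := twisted_act_bilinear k H K act pi.
  split=> // [x|a b x]; last exact: twisted_actA.
  have [[_ _ act_id _] _ _] := act_modalg.
  rewrite /twisted_act comul1 tliftE /bcomp /= act_id.
  by rewrite (crossed_hom1 k H K act) // /amul mul1r.
split=> // a b.
by rewrite -(twisted_act_one k H K act) // twA twisted_act_one.
Qed.
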